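(* Let $m_j$ and $p_j$ be positive integers, let $\widehat{\lambda}_j\in\mathbb{C}$, let $R_j\in\mathbb{R}^{p_j\times p_j}$ be entrywise nonnegative, and let $r_{\mathrm r}:=[\max_i(R_j)_{i1},\dots,\max_i(R_j)_{ip_j}]$ be the row vector of column maxima of $R_j$. Define nonnegative matrices $\mathsf{R}_0,\dots,\mathsf{R}_{m_j-1}\in\mathbb{R}^{p_j\times p_j}$ by $\mathsf{R}_0:=R_j$ and $$\mathsf{R}_{k+1}:=|\widehat{\lambda}_j+k+1|\,\mathsf{R}_k+\Bigl|\prod_{i=0}^{k}(\widehat{\lambda}_j+i)\Bigr|R_j+\mathbf{1}_{p_j}r_{\mathrm r}\mathsf{R}_k,\qquad k=0,\dots,m_j-2.$$ Then $$\prod_{i=0}^{m_j-1}\langle(\widehat{\lambda}_j+i)I_{p_j},R_j\rangle\subseteq\Bigl\langle\Bigl(\prod_{i=0}^{m_j-1}(\widehat{\lambda}_j+i)\Bigr)I_{p_j},\ \mathsf{R}_{m_j-1}\Bigr\rangle.$$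
   Context: $\mathbf{1}_{p_j}\in\mathbb{R}^{p_j}$ is the column vector of all ones; $I_k$ is the $k\times k$ identity matrix; $|\cdot|$ of a matrix is the entrywise modulus and inequalities between real matrices are entrywise. For $C\in\mathbb{C}^{m\times n}$ and entrywise nonnegative $R\in\mathbb{R}^{m\times n}$, $\langle C,R\rangle:=\{M\in\mathbb{C}^{m\times n}:|M-C|\le R\}$ is the interval matrix with midpoint $C$ and radius $R$. Products of interval matrices are results of complex interval arithmetic: the product $\boldsymbol{A}\boldsymbol{B}$ of two interval matrices is an interval matrix containing all products $MN$ with $M\in\boldsymbol{A}$, $N\in\boldsymbol{B}$; the operation is inclusion isotonic ($\boldsymbol{A}\subseteq\boldsymbol{A}'$ and $\boldsymbol{B}\subseteq\boldsymbol{B}'$ imply $\boldsymbol{A}\boldsymbol{B}\subseteq\boldsymbol{A}'\boldsymbol{B}'$), and it satisfies $\langle A,R\rangle\langle B,S\rangle\subseteq\langle AB,\ |A|S+R|B|+RS\rangle$. A product of interval matrices over $i$ is evaluated successively, the factor with the larger index multiplying from the left: $\prod_{i=0}^{k+1}\boldsymbol{A}_i=\boldsymbol{A}_{k+1}\prod_{i=0}^{k}\boldsymbol{A}_i$. *)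

(* Defs.v *)
From mathcomp Require Import all_boot all_order all_algebra.
From mathcomp Require Import boolp classical_sets reals.
From mathcomp Require Export complex.

Set Implicit Arguments.
Unset Strict Implicit.
Unset Printing Implicit Defensive.

Import Order.TTheory GRing.Theory Num.Theory.

Local Open Scope classical_set_scope.
Local Open Scope ring_scope.
Local Open Scope complex_scope.

Definition mxle (R : realType) (m n : nat) (A B : 'M[R]_(m, n)) : Prop :=
  forall i j, A i j <= B i j.

(* [Normc.normc] is the modulus with values in R; the generic norm `|z| on
   R[i] takes its values in R[i]. *)
Definition mxmod (R : realType) (m n : nat) (A : 'M[R[i]]_(m, n)) :
    'M[R]_(m, n) :=
  map_mx (@Normc.normc R) A.

(* An interval matrix only when Rad is entrywise nonnegative. *)
Definition imx (R : realType) (m n : nat)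
    (C : 'M[R[i]]_(m, n)) (Rad : 'M[R]_(m, n)) : set 'M[R[i]]_(m, n) :=
  [set M | mxle (mxmod (M - C)) Rad].

Definition interval_mx (R : realType) (m n : nat) (A : set 'M[R[i]]_(m, n)) :
    Prop :=
  exists C : 'M[R[i]]_(m, n), exists Rad : 'M[R]_(m, n),
    mxle 0 Rad /\ A = imx C Rad.

(* Any product of interval matrices provided by complex interval arithmetic.
   It is a function on all sets of matrices, but it is constrained on interval
   matrices only. *)
Record interval_product (R : realType)
    (mul : forall m n q : nat,
       set 'M[R[i]]_(m, n) -> set 'M[R[i]]_(n, q) -> set 'M[R[i]]_(m, q)) :
    Prop := IntervalProduct {
  iprod_interval : forall (m n q : nat)
      (A : set 'M[R[i]]_(m, n)) (B : set 'M[R[i]]_(n, q)),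
    interval_mx A -> interval_mx B -> interval_mx (mul m n q A B);
  iprod_contains : forall (m n q : nat)
      (A : set 'M[R[i]]_(m, n)) (B : set 'M[R[i]]_(n, q)),
    interval_mx A -> interval_mx B ->
    forall M N, A M -> B N -> mul m n q A B (M *m N);
  iprod_isotonic : forall (m n q : nat)
      (A A' : set 'M[R[i]]_(m, n)) (B B' : set 'M[R[i]]_(n, q)),
    interval_mx A -> interval_mx A' -> interval_mx B -> interval_mx B' ->
    A `<=` A' -> B `<=` B' -> mul m n q A B `<=` mul m n q A' B';
  iprod_midrad : forall (m n q : nat)
      (A : 'M[R[i]]_(m, n)) (Ra : 'M[R]_(m, n))
      (B : 'M[R[i]]_(n, q)) (Rb : 'M[R]_(n, q)),
    mxle 0 Ra -> mxle 0 Rb ->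
    mul m n q (imx A Ra) (imx B Rb) `<=`
      imx (A *m B) (mxmod A *m Rb + Ra *m mxmod B + Ra *m Rb)
}.

(* imxprod mul A k is the product of A 0, ..., A k (k.+1 factors), larger
   indices multiplying from the left. *)
Fixpoint imxprod (R : realType)
    (mul : forall m n q : nat,
       set 'M[R[i]]_(m, n) -> set 'M[R[i]]_(n, q) -> set 'M[R[i]]_(m, q))
    (p : nat) (A : nat -> set 'M[R[i]]_p) (k : nat) : set 'M[R[i]]_p :=
  if k is k'.+1 then mul p p p (A k) (imxprod mul A k') else A 0%N.

(* The default value 0 of the maximum is harmless: colmax is only applied to
   nonnegative matrices. *)
Definition colmax (R : realType) (p : nat) (A : 'M[R]_p) : 'rV[R]_p :=
  \row_j \big[Num.max/0]_(i < p) A i j.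

Fixpoint radseq (R : realType) (p : nat) (lam : R[i]) (Rj : 'M[R]_p)
    (k : nat) : 'M[R]_p :=
  if k is k'.+1 then
    Normc.normc (lam + k%:R) *: radseq lam Rj k'
    + Normc.normc (\prod_(i < k) (lam + i%:R)) *: Rj
    + (const_mx 1 : 'cV[R]_p) *m colmax Rj *m radseq lam Rj k'
  else Rj.

(* Main.v *)
Require Import Defs.
From mathcomp Require Import all_boot all_order all_algebra.
From mathcomp Require Import boolp classical_sets reals.

Set Implicit Arguments.
Unset Strict Implicit.
Unset Printing Implicit Defensive.

Import Order.TTheory GRing.Theory Num.Theory.

Local Open Scope classical_set_scope.
Local Open Scope ring_scope.
Local Open Scope complex_scope.

(** The inclusion is proved by induction on the number of factors. If the
    product of the first [k.+1] factors lies in the interval matrix with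
    midpoint [P%:M] and radius [Rad], inclusion isotonicity and the
    midpoint-radius bound put the next product in the interval matrix with
    midpoint [(a * P)%:M], where [a = lam + k.+1], and radius
    [|a| Rad + |P| Rj + Rj Rad]; the moduli of the scalar midpoints act as
    scalars ([mxmod_scalar]). Each entry of [Rj] is at most the maximum of its
    column, so [Rj] is at most the matrix all of whose rows are [colmax Rj]
    ([mxle_colmax]). Since [Rad] is nonnegative, replacing [Rj] by that matrix
    in the last term only enlarges the radius, and gives the recursion for
    [radseq]. *)

Section MatrixOrder.

Variable R : realType.

Lemma mxle_refl m n (A : 'M[R]_(m, n)) : mxle A A.
Proof. by move=> i j. Qed.

Lemma mxleD m n (A B C D : 'M[R]_(m, n)) :
  mxle A B -> mxle C D -> mxle (A + C) (B + D).
Proof. by move=> AB CD i j; rewrite !mxE lerD. Qed.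

Lemma mxleM2r m n q (C : 'M[R]_(n, q)) (A B : 'M[R]_(m, n)) :
  mxle 0 C -> mxle A B -> mxle (A *m C) (B *m C).
Proof.
move=> C0 AB i j; rewrite !mxE; apply: ler_sum => k _.
by apply: ler_wpM2r => //; have := C0 k j; rewrite mxE.
Qed.

Lemma mxleD_ge0 m n (A B : 'M[R]_(m, n)) :
  mxle 0 A -> mxle 0 B -> mxle 0 (A + B).
Proof. by move=> A0 B0; rewrite -[0]addr0; apply: mxleD. Qed.

Lemma mxleM_ge0 m n q (A : 'M[R]_(m, n)) (B : 'M[R]_(n, q)) :
  mxle 0 A -> mxle 0 B -> mxle 0 (A *m B).
Proof. by move=> A0 B0; rewrite -(mul0mx m B); apply: mxleM2r. Qed.

Lemma mxleZ_ge0 m n (a : R) (A : 'M[R]_(m, n)) :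
  0 <= a -> mxle 0 A -> mxle 0 (a *: A).
Proof.
by move=> a0 A0 i j; have := A0 i j; rewrite !mxE => ?; apply: mulr_ge0.
Qed.

Lemma mxle_colmax p (A : 'M[R]_p) :
  mxle A ((const_mx 1 : 'cV[R]_p) *m colmax A).
Proof.
move=> i j; rewrite mxE big_ord1 !mxE mul1r.
exact: (le_bigmax _ (fun k => A k j)).
Qed.

End MatrixOrder.

Section IntervalMatrix.

Variable R : realType.

Lemma normc_ge0 (z : R[i]) : 0 <= Normc.normc z.
Proof. by case: z => a b /=; apply: sqrtr_ge0. Qed.

Lemma mxmod_scalar p (a : R[i]) : mxmod (a%:M : 'M_p) = (Normc.normc a)%:M.
Proof.
apply/matrixP => i j; rewrite !mxE; case: (i == j) => //.
by rewrite !mulr0n Normc.normc0.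
Qed.

Lemma imx_subset m n (C : 'M[R[i]]_(m, n)) (A B : 'M[R]_(m, n)) :
  mxle A B -> imx C A `<=` imx C B.
Proof. by move=> AB M MA i j; apply: le_trans (MA i j) (AB i j). Qed.

Lemma interval_imx m n (C : 'M[R[i]]_(m, n)) (A : 'M[R]_(m, n)) :
  mxle 0 A -> interval_mx (imx C A).
Proof. by move=> A0; exists C, A. Qed.

Lemma radseq_ge0 p (lam : R[i]) (Rj : 'M[R]_p) k :
  mxle 0 Rj -> mxle 0 (radseq lam Rj k).
Proof.
move=> Rj0; elim: k => [//|k IHk] /=; apply: mxleD_ge0.
  by apply: mxleD_ge0; apply: mxleZ_ge0 => //; apply: normc_ge0.
apply: mxleM_ge0 => // i j.
exact: le_trans (Rj0 i j) (mxle_colmax Rj i j).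
Qed.

Variable mul : forall m n q : nat,
  set 'M[R[i]]_(m, n) -> set 'M[R[i]]_(n, q) -> set 'M[R[i]]_(m, q).
Hypothesis mulP : interval_product mul.

Lemma interval_imxprod p (A : nat -> set 'M[R[i]]_p) k :
  (forall i, interval_mx (A i)) -> interval_mx (imxprod mul A k).
Proof.
by move=> AI; elim: k => [|k IHk] //=; apply: (iprod_interval mulP).
Qed.

(** The midpoint-radius bound for two factors with scalar midpoints. *)
Lemma iprod_scalar p (a b : R[i]) (Ra Rb : 'M[R]_p) :
  mxle 0 Ra -> mxle 0 Rb ->
  mul (imx a%:M Ra) (imx b%:M Rb) `<=`
    imx (a * b)%:M
      (Normc.normc a *: Rb + Normc.normc b *: Ra + Ra *m Rb).
Proof.
move=> Ra0 Rb0; have := iprod_midrad mulP (A := a%:M) (B := b%:M) Ra0 Rb0.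
by rewrite !mxmod_scalar -scalar_mxM mul_scalar_mx mul_mx_scalar.
Qed.

Lemma imxprod_sub_radseq p (lam : R[i]) (Rj : 'M[R]_p) k :
  mxle 0 Rj ->
  imxprod mul (fun i => imx (lam + i%:R)%:M Rj) k `<=`
    imx (\prod_(i < k.+1) (lam + i%:R))%:M (radseq lam Rj k).
Proof.
move=> Rj0; elim: k => [|k IHk]; first by rewrite big_ord1.
have Rk0 := radseq_ge0 lam k Rj0.
rewrite big_ord_recr [X in imx X%:M]mulrC [imxprod _ _ _]/=.
set P := imxprod _ _ _.
have PI : interval_mx P.
  by apply: interval_imxprod => i; apply: interval_imx.
have FI := interval_imx (lam + k.+1%:R)%:M Rj0.
have QI := interval_imx (\prod_(i < k.+1) (lam + i%:R))%:M Rk0.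
apply: subset_trans (iprod_isotonic mulP FI FI PI QI (@subset_refl _ _) IHk) _.
apply: subset_trans (iprod_scalar Rj0 Rk0) _.
apply: imx_subset; apply: mxleD; first exact: mxle_refl.
by apply: mxleM2r => //; apply: mxle_colmax.
Qed.

End IntervalMatrix.

Theorem theorem4p7 (R : realType)
    (mul : forall m n q : nat,
       set 'M[R[i]]_(m, n) -> set 'M[R[i]]_(n, q) -> set 'M[R[i]]_(m, q))
    (mulP : interval_product mul)
    (m p : nat) (m_gt0 : (0 < m)%N) (p_gt0 : (0 < p)%N)
    (lam : R[i]) (Rj : 'M[R]_p) (Rj_ge0 : mxle 0 Rj) :
  imxprod mul (fun i => imx ((lam + i%:R)%:M) Rj) m.-1 `<=`
    imx ((\prod_(i < m) (lam + i%:R))%:M) (radseq lam Rj m.-1).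
Proof.
case: m m_gt0 => // k _.
exact: (imxprod_sub_radseq mulP).
Qed.
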